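(* Let $n\geq 2$ be an integer and let $X$ be an $n$-Urysohn topological space. Then $|X|\leq d(X)^{\,n\text{-}\psi_c(X)\cdot wt(X)}$.
   Context: Throughout $n\ge 2$ is an integer. The Urysohn number $U(X)$ of a space $X$ is the least cardinal $\kappa$ such that for every $A\subseteq X$ with $|A|\geq\kappa$ there exist open neighbourhoods $U_a$ of $a$ ($a\in A$) with $\bigcap_{a\in A}\overline{U_a}=\emptyset$. $X$ is $n$-Urysohn if $U(X)\leq n$. For an $n$-Urysohn space $X$, the $n$-closed pseudocharacter $n\text{-}\psi_c(X)$ is the minimum infinite cardinal $\kappa$ such that for each point $x\in X$ there is a collection $\{V(\alpha,x):\alpha<\kappa\}$ of open neighbourhoods of $x$ such that whenever $x_1,\dots,x_n\in X$ are $n$ different points, $\bigcap_{\alpha<\kappa}\overline{V(\alpha,x_1)}\cap\dots\cap\bigcap_{\alpha<\kappa}\overline{V(\alpha,x_n)}=\emptyset$. The weak tightness $wt(X)$ is the least infinite cardinal $\kappa$ for which there is a cover $\mathcal{C}$ of $X$ such that $|\mathcal{C}|\leq 2^\kappa$ and, for all $C\in\mathcal{C}$, $t(C)\leq\kappa$ (tightness of the subspace $C$) and $X=\bigcup_{B\in[C]^{\leq 2^\kappa}}\overline{B}$, where $[C]^{\leq 2^\kappa}$ is the family of subsets of $C$ of cardinality at most $2^\kappa$. $d(X)$ is the density of $X$; $d$ and $t$ are multiplied by $\omega$ (so they are always infinite). *)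

(* Defs.v *)
From mathcomp Require Import all_boot.
From mathcomp Require Import boolp classical_sets functions cardinality.
From mathcomp Require Import topology.

Set Implicit Arguments.
Unset Strict Implicit.
Unset Printing Implicit Defensive.

Local Open Scope classical_set_scope.
Local Open Scope card_scope.

(* Cardinals are represented by types, [K] standing for its cardinality, and
   are compared with [[set: K] #<= [set: L]]. *)
Definition is_least_cardinal (P : Type -> Prop) (K : Type) : Prop :=
  P K /\ forall L : Type, P L -> [set: K] #<= [set: L].

(* A type of the least cardinality satisfying [P]. The default value [unit] is
   never used below: see [least_cardinalP] and its instances. *)
Definition least_cardinal (P : Type -> Prop) : Type :=
  if pselect (exists K, is_least_cardinal P K) is left ex then sval (cid ex)
  else unit.

(* [K] ranges over all cardinals here, not only the infinite ones. *)
Definition urysohn_bound (X : topologicalType) (K : Type) : Prop :=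
  forall A : set X, [set: K] #<= A ->
    exists U : X -> set X,
      (forall a, A a -> open_nbhs a (U a)) /\
      \bigcap_(a in A) closure (U a) = set0.

Definition urysohn_number (X : topologicalType) : Type :=
  least_cardinal (urysohn_bound X).

Definition n_urysohn (n : nat) (X : topologicalType) : Prop :=
  [set: urysohn_number X] #<= `I_n.

Definition closed_pseudocharacter_bound (n : nat) (X : topologicalType)
    (K : Type) : Prop :=
  infinite_set [set: K] /\
  exists V : K -> X -> set X,
    (forall k x, open_nbhs x (V k x)) /\
    forall x : 'I_n -> X, injective x ->
      \bigcap_(i in [set: 'I_n])
        \bigcap_(k in [set: K]) closure (V k (x i)) = set0.

(* Meaningful only when [n_urysohn n X]. *)
Definition closed_pseudocharacter (n : nat) (X : topologicalType) : Type :=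
  least_cardinal (closed_pseudocharacter_bound n X).

(* The infinity requirement gives the usual density multiplied by omega. *)
Definition density_bound (X : topologicalType) (K : Type) : Prop :=
  infinite_set [set: K] /\ exists2 S : set X, dense S & S #<= [set: K].

Definition density (X : topologicalType) : Type :=
  least_cardinal (density_bound X).

Definition tightness_bound (X : topologicalType) (K : Type) : Prop :=
  infinite_set [set: K] /\
  forall (A : set X) (x : X), closure A x ->
    exists B : set X, [/\ B `<=` A, B #<= [set: K] & closure B x].

Definition tightness (X : topologicalType) : Type :=
  least_cardinal (tightness_bound X).

(* [[set: set K]] has cardinality 2 ^ K, and [set_type C] carries the subspace
   topology (unlike [subspace C], whose points are all those of X). *)
Definition weak_tightness_bound (X : topologicalType) (K : Type) : Prop :=
  infinite_set [set: K] /\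
  exists CC : set (set X),
    [/\ CC #<= [set: set K],
        \bigcup_(C in CC) C = [set: X] &
        forall C : set X, CC C ->
          [set: tightness (set_type C)] #<= [set: K] /\
          \bigcup_(B in [set B : set X | B `<=` C /\ B #<= [set: set K]])
            closure B = [set: X]].

Definition weak_tightness (X : topologicalType) : Type :=
  least_cardinal (weak_tightness_bound X).

Definition card_invariant (P : Type -> Prop) : Prop :=
  forall K L : Type, [set: K] #= [set: L] -> P K -> P L.

Lemma exists_least_card (I : Type) (F : I -> Type) :
  inhabited I -> exists i, forall j, [set: F i] #<= [set: F j].
Proof.
move=> [i0].
have [[i Fi0]|Fn0] := pselect (exists i, ~ inhabited (F i)).
  exists i => j; have -> : [set: F i] = set0.
    by apply/seteqP; split => // x _; apply: Fi0; exists.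
  exact: card_ge0.
have [|M [MP Mmax]] := @Zorn_bigcup (forall i, F i)
    [set M | forall g h, M g -> M h -> forall i, g i = h i -> g = h].
  move=> C CP Ctot g h [A CA Ag] [B CB Bh] i gh.
  have [AB|BA] := Ctot _ _ CA CB.
    exact: (CP _ CB g h (AB _ Ag) Bh i).
  exact: (CP _ CA g h Ag (BA _ Bh) i).
have [i Mi] : exists i, forall y : F i, exists2 g, M g & g i = y.
  apply: contrapT => /forallNP nM.
  have yex i : {y : F i | forall g, M g -> g i <> y}.
    apply: cid; apply: contrapT => nex; apply: (nM i) => y.
    apply: contrapT => ng; apply: nex; exists y => g Mg gy.
    by apply: ng; exists g.
  pose y i := sval (yex i).
  have yM i : forall g, M g -> g i <> y i := svalP (yex i).
  apply: (Mmax (M `|` [set y])).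
    split; first by move=> g Mg; left.
    by move=> /(_ y (or_intror erefl)) /(yM i0).
  move=> g h [Mg|->] [Mh|->] j //; first exact: MP.
    by move=> gy; case: (yM j g).
  by move=> gy; case: (yM j h).
exists i => j; apply: (@card_le_trans _ _ _ M).
  have -> : [set: F i] = (fun g => g i) @` M.
    by apply/seteqP; split => // y _; have [g Mg <-] := Mi y; exists g.
  exact: card_image_le.
have gj : set_inj M (fun g : forall i, F i => g j).
  by move=> g h /set_mem Mg /set_mem Mh; exact: MP.
by rewrite -(card_le_eql (inj_card_eq gj)); exact: card_leT.
Qed.

Lemma least_cardinalP (P : Type -> Prop) :
  card_invariant P -> (exists K, P K) -> is_least_cardinal P (least_cardinal P).
Proof.
move=> Pinv [K0 PK0].
suff ex : exists K, is_least_cardinal P K.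
  by rewrite /least_cardinal; case: pselect => // e; exact: (svalP (cid e)).
pose I := {A : set K0 | P A}.
have PT : P [set: K0] by apply: Pinv PK0; exact: card_setT_sym.
have [[A PA] Amin] := @exists_least_card I (fun A => set_type (sval A))
  (inhabits (exist _ _ PT)).
exists A; split=> // L PL.
have [b le_b] := @exists_least_card bool
  (fun b => if b then K0 : Type else L) (inhabits true).
case: b le_b => le_b.
  apply: card_le_trans (le_b false).
  by rewrite (card_le_eql (card_setT A)); exact: card_leT.
have /card_subP[C CL _] := le_b true.
have PC : P C.
  by apply: Pinv PL; apply/card_esym/(card_eq_trans (card_setT C)).
rewrite -(card_le_eqr CL) -(card_le_eqr (card_setT C)).
exact: (Amin (exist _ C PC)).
Qed.

Lemma card_le_inj (K L : Type) (f : K -> L) :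
  injective f -> [set: K] #<= [set: L].
Proof.
move=> fi; have si : set_inj [set: K] f by move=> x y _ _ /fi.
by rewrite -(card_le_eql (inj_card_eq si)); exact: card_leT.
Qed.

Lemma card_leT_inj (K L : Type) :
  [set: K] #<= [set: L] -> exists f : K -> L, injective f.
Proof.
move=> /card_leP[f].
exists (fun k => set_val (f (SigSub (mem_set (I : setT k))))) => x y.
by move=> /val_inj /(@inj _ _ _ f); rewrite !inE => /(_ I I) [].
Qed.

Lemma card_le_set (K L : Type) :
  [set: K] #<= [set: L] -> [set: set K] #<= [set: set L].
Proof.
move=> /card_leT_inj[f fi].
apply: (@card_le_inj _ _ (fun A => f @` A)) => A B AB.
apply/seteqP; split=> x Ax.
  have : (f @` B) (f x) by rewrite -AB; exists x.
  by move=> [y By /fi <-].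
have : (f @` A) (f x) by rewrite AB; exists x.
by move=> [y By /fi <-].
Qed.

Lemma card_le_setT (T : Type) : [set: T] #<= [set: set T].
Proof.
apply: (@card_le_inj _ _ (@set1 T)) => x y xy.
by have : [set x] x by []; rewrite xy.
Qed.

Lemma card_setT_nle (T : Type) : ~ ([set: set T] #<= [set: T]).
Proof.
move=> /card_leT_inj[f fi].
pose D := [set x | exists2 A : set T, f A = x & ~ A x].
have [DfD|nDfD] := pselect (D (f D)); last by apply: (nDfD); exists D.
by have [A /fi -> nDfD] := DfD; exact: nDfD.
Qed.

Lemma card_eq_infinite (K L : Type) :
  [set: K] #= [set: L] -> infinite_set [set: K] -> infinite_set [set: L].
Proof. by rewrite card_eq_le => /andP[KL _] Ki /(card_le_finite KL). Qed.

Lemma infinite_sum_nat (T : Type) : infinite_set [set: T + nat].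
Proof. by apply/infiniteP; apply: (@card_le_inj _ _ inr) => x y []. Qed.

Lemma card_le_sum_nat (T : Type) : [set: T] #<= [set: T + nat].
Proof. by apply: (@card_le_inj _ _ inl) => x y []. Qed.

Lemma urysohn_numberP (X : topologicalType) :
  is_least_cardinal (urysohn_bound X) (urysohn_number X).
Proof.
apply: least_cardinalP.
  by move=> K L KL PK A; rewrite -(card_le_eql KL); exact: PK.
exists (set X) => A XA; exfalso; apply: (@card_setT_nle X).
by apply: (card_le_trans XA); exact: card_leT.
Qed.

Lemma closed_pseudocharacterP (n : nat) (X : topologicalType) :
  n_urysohn n X ->
  is_least_cardinal (closed_pseudocharacter_bound n X)
    (closed_pseudocharacter n X).
Proof.
move=> Xn; apply: least_cardinalP.
  move=> K L KL [Ki [V [Vx V0]]]; split; first exact: card_eq_infinite Ki.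
  have KL' : [set: K] #<= [set: L] by move: KL; rewrite card_eq_le => /andP[].
  have [f fi] := card_leT_inj KL'.
  pose W l x :=
    if pselect (exists k, f k = l) is left ex then V (sval (cid ex)) x
    else [set: X].
  exists W; split=> [l x|x xi].
    rewrite /W; case: pselect => // _; split=> //; exact: openT.
  apply/seteqP; split=> // y yW; rewrite -(V0 x xi) => i _ k _.
  have := yW i I (f k) I; rewrite /W; case: pselect => [e|[]]; last by exists k.
  by case: cid => k' /= /fi ->.
exists (set X + nat)%type; split; first exact: infinite_sum_nat.
exists (fun k x => if k is inl A then
                     if pselect (open_nbhs x A) is left _ then A else [set: X]
                   else [set: X]).
split=> [[A|_] x|x xi].
- case: pselect => [//|_]; split=> //; exact: openT.
- by split=> //; exact: openT.
have [U [Ux U0]] : exists U : X -> set X,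
    (forall a, range x a -> open_nbhs a (U a)) /\
    \bigcap_(a in range x) closure (U a) = set0.
  apply: (urysohn_numberP X).1; apply: (card_le_trans Xn).
  have xi' : set_inj [set: 'I_n] x by move=> i j _ _ /xi.
  rewrite (card_le_eqr (inj_card_eq xi')).
  by rewrite -(card_le_eqr card_II); exact: card_lexx.
apply/seteqP; split=> // y yV; rewrite -U0 => _ [i _ <-].
by have := yV i I (inl (U (x i))) I; case: pselect => //; case; apply: Ux; exists i.
Qed.

Lemma densityP (X : topologicalType) :
  is_least_cardinal (density_bound X) (density X).
Proof.
apply: least_cardinalP.
  move=> K L KL [Ki [S dS SK]]; split; first exact: card_eq_infinite Ki.
  by exists S; rewrite // -(card_le_eqr KL).
exists (X + nat)%type; split; first exact: infinite_sum_nat.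
exists [set: X]; last exact: card_le_sum_nat.
by move=> O [x Ox] _; exists x.
Qed.

Lemma tightness_bound_sum_nat (X : topologicalType) :
  tightness_bound X (X + nat)%type.
Proof.
split; first exact: infinite_sum_nat.
move=> A x Ax; exists A; split=> //.
by apply: card_le_trans (card_le_sum_nat X); exact: card_leT.
Qed.

Lemma tightnessP (X : topologicalType) :
  is_least_cardinal (tightness_bound X) (tightness X).
Proof.
apply: least_cardinalP; last by exists (X + nat)%type; exact: tightness_bound_sum_nat.
move=> K L KL [Ki PK]; split; first exact: card_eq_infinite Ki.
move=> A x /PK[B [BA BK Bx]]; exists B.
by split; rewrite // -(card_le_eqr KL).
Qed.

Lemma weak_tightnessP (X : topologicalType) :
  is_least_cardinal (weak_tightness_bound X) (weak_tightness X).
Proof.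
apply: least_cardinalP.
  move=> K L KL [Ki [CC [CCK CCX CCP]]]; split; first exact: card_eq_infinite Ki.
  have KL' : [set: K] #<= [set: L] by move: KL; rewrite card_eq_le => /andP[].
  exists CC; split=> //; first exact: card_le_trans (card_le_set KL').
  move=> C /CCP[tC CX]; split; first exact: card_le_trans KL'.
  apply/seteqP; split=> // x _.
  have [B [BC BK] Bx] : (\bigcup_(B in
      [set B : set X | B `<=` C /\ B #<= [set: set K]]) closure B) x by rewrite CX.
  exists B => //; split=> //; exact: card_le_trans (card_le_set KL').
have XK := card_le_sum_nat X.
exists (X + nat)%type; split; first exact: infinite_sum_nat.
exists [set [set: X]]; split.
- have -> : [set [set: X]] = (fun _ : unit => [set: X]) @` [set: unit].
    by apply/seteqP; split=> [_ ->|_ [_ _ <-]] //; exists tt.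
  apply: (card_le_trans (card_image_le _ _)).
  by apply: (@card_le_inj _ _ (fun _ : unit => set0)) => -[] [].
- by rewrite bigcup_set1.
- move=> _ ->; split.
    apply: (@card_le_trans _ _ _ [set: set_type [set: X] + nat]).
      by apply: (tightnessP _).2; exact: tightness_bound_sum_nat.
    apply: (@card_le_inj _ _ (fun k => match k with
      | inl x => inl (set_val x) | inr m => inr m end)).
    by move=> [x|m] [y|m'] [] // => [/val_inj ->|->].
  apply/seteqP; split=> // x _; exists [set: X]; last exact: subset_closure.
  by split=> //; apply: (card_le_trans XK); exact: card_le_setT.
Qed.

(* Main.v *)
Require Import Defs.
From mathcomp Require Import all_boot.
From mathcomp Require Import boolp classical_sets functions cardinality.
From mathcomp Require Import topology.

(** Let P, W and D have the cardinalities of the n-closed pseudocharacter, of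
    the weak tightness and of the density of X, and let E be the type of
    functions from P * W to D. As P * W is infinite, Hessenberg's theorem
    ([card_le_prod_self]) makes E absorb everything: E * E, E ^ (P * W) and
    2 ^ W all have cardinality at most that of E, so a union of at most E sets
    of cardinality at most E has cardinality at most E ([card_le_bigcup]). As
    X is covered by at most 2 ^ W sets C as in the definition of weak
    tightness, it suffices to bound each of them by E.

    Fix such a C. Every point of a dense set S of size at most D is in the
    closure of some subset of C of size at most 2 ^ W; the union of these
    subsets is dense in X, is contained in C, and has size at most E
    ([exists_small_dense]). Call it S again. For x in C and p in P, the point x
    is in the closure of the trace on S of its open neighbourhood V p x, and
    since C has tightness at most W, this trace has a subset B p of size at
    most W whose closure contains x. Enumerating each B p by W turns this
    family into a code of x in S ^ (P * W), of which there are at most E. If n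
    distinct points x_i had the same family B, then any of them would be in
    the closure of B p, hence of V p x_i, for all p and i, which the choice of
    V forbids. So only finitely many points share a code, and C has size at
    most E ([card_le_tight_dense]). *)

Set Implicit Arguments.
Unset Strict Implicit.
Unset Printing Implicit Defensive.

Local Open Scope classical_set_scope.
Local Open Scope card_scope.

(** * Comparison of cardinals *)

Lemma card_le_total (T U : Type) (A : set T) (B : set U) :
  A #<= B \/ B #<= A.
Proof.
have [b le_b] := @exists_least_card bool
  (fun b => if b then set_type A : Type else set_type B) (inhabits true).
case: b le_b => le_b; [left; have := le_b false|right; have := le_b true];
  by rewrite (card_le_eql (card_setT _)) (card_le_eqr (card_setT _)).
Qed.

(** Comparison of sets realized by a total function; the point of [U] is the
    value outside [A]. *)
Lemma card_le_exists_inj (T U : Type) (A : set T) (B : set U) :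
  U -> A #<= B -> exists f : T -> U,
    (forall x, A x -> B (f x)) /\
    (forall x y, A x -> A y -> f x = f y -> x = y).
Proof.
move=> u0; rewrite -(card_le_eql (card_setT A)) -(card_le_eqr (card_setT B)).
move=> /card_leT_inj[g gi].
exists (fun x => if pselect (A x) is left Ax then set_val (g (SigSub (mem_set Ax)))
                 else u0); split=> [x Ax|x y Ax Ay].
  by case: pselect => // Ax'; exact: set_valP.
by case: pselect => // Ax'; case: pselect => // Ay' /val_inj /gi [].
Qed.

Lemma inj_card_le_set (T U : Type) (A : set T) (B : set U) (f : T -> U) :
  (forall x, A x -> B (f x)) ->
  (forall x y, A x -> A y -> f x = f y -> x = y) -> A #<= B.
Proof.
move=> fB fi; have si : set_inj A f.
  by move=> x y /set_mem Ax /set_mem Ay; exact: fi.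
rewrite -(card_le_eql (inj_card_eq si)); apply: subset_card_le => _ [x Ax <-].
exact: fB.
Qed.

(** * Hessenberg's theorem *)

(** The set A when [G] is the graph of a map from A * A to A, read off the
    diagonal. *)
Definition pairing_field {T : Type} (G : set (T * T * T)) : set T :=
  [set x | exists z, G (x, x, z)].

(** [G] is the graph of an injection from A * A to A, for A the set
    [pairing_field G]. *)
Definition pairing_graph {T : Type} (G : set (T * T * T)) : Prop :=
  [/\ forall x y z z', G (x, y, z) -> G (x, y, z') -> z = z',
      forall x y x' y' z, G (x, y, z) -> G (x', y', z) -> x = x' /\ y = y',
      forall x y z, G (x, y, z) ->
        [/\ pairing_field G x, pairing_field G y & pairing_field G z] &
      forall x y, pairing_field G x -> pairing_field G y ->
        exists z, G (x, y, z)].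

(** Each condition in [pairing_graph] concerns at most two triples, so it
    passes to directed unions. *)
Lemma pairing_graph_directed (T : Type) (H : set (T * T * T)) :
  (forall t u, H t -> H u ->
     exists G, [/\ pairing_graph G, G `<=` H, G t & G u]) ->
  pairing_graph H.
Proof.
move=> dirH.
have fieldS G : G `<=` H -> pairing_field G `<=` pairing_field H.
  by move=> GH x [z Gz]; exists z; exact: GH.
split.
- by move=> x y z z' /dirH h /h[G [[G1 _ _ _] _]]; exact: G1.
- by move=> x y x' y' z /dirH h /h[G [[_ G2 _ _] _]]; exact: G2.
- move=> x y z Hz; have [G [[_ _ G3 _] /fieldS GH /G3[Gx Gy Gz] _]] := dirH _ _ Hz Hz.
  by split; exact: GH.
- move=> x y [z Hx] [z' Hy]; have [G [[_ _ _ G4] GH Gx Gy]] := dirH _ _ Hx Hy.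
  have [||w Gw] := G4 x y; [by exists z|by exists z'|].
  by exists w; exact: GH.
Qed.

(** Any injection [q] of I * I into I, transported along an injection [i] of I
    into T. *)
Lemma pairing_graph_fun (T I : Type) (i : I -> T) (q : I -> I -> I) :
  injective i ->
  (forall a b a' b', q a b = q a' b' -> a = a' /\ b = b') ->
  pairing_graph [set t | exists a b, t = (i a, i b, i (q a b))].
Proof.
move=> ii qi.
have fieldE a : pairing_field [set t | exists a b, t = (i a, i b, i (q a b))] (i a).
  by exists (i (q a a)), a, a.
split.
- by move=> _ _ _ z' [a [b [-> -> ->]]] [a' [b' [/ii <- /ii <- ->]]].
- by move=> _ _ x' y' _ [a [b [-> -> ->]]] [a' [b' [-> -> /ii/qi[<- <-]]]].
- by move=> _ _ _ [a [b [-> -> ->]]]; split; exact: fieldE.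
- move=> _ _ [_ [a [_ [-> _ _]]]] [_ [b [_ [-> _ _]]]].
  by exists (i (q a b)), a, b.
Qed.

(** Zorn's lemma, applied to the pairing graphs containing the one carried over
    from a pairing function on the natural numbers; this keeps the field
    infinite. *)
Lemma exists_maximal_pairing_graph (T : Type) : infinite_set [set: T] ->
  exists M : set (T * T * T),
    [/\ pairing_graph M, infinite_set (pairing_field M) &
        forall G, pairing_graph G -> M `<=` G -> G `<=` M].
Proof.
move=> /infiniteP /card_leT_inj[i ii].
have [h hi] : exists h : nat * nat -> nat, injective h.
  by apply: card_leT_inj; move: card_nat2; rewrite card_eq_le => /andP[].
pose G0 := [set t | exists a b, t = (i a, i b, i (h (a, b)))].
have gG0 : pairing_graph G0.
  by apply: (@pairing_graph_fun _ _ i (fun a b => h (a, b))) => // a b a' b' /hi[].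
have [F FP Ftot|G [gG Gmax]] :=
    @Zorn_bigcup _ [set G | pairing_graph (G `|` G0)].
  apply: pairing_graph_directed => t u.
  have G0F : G0 `<=` (\bigcup_(G in F) G) `|` G0 by move=> v; right.
  have FF G : F G -> G `|` G0 `<=` (\bigcup_(G in F) G) `|` G0.
    by move=> FG v [Gv|]; [left; exists G|right].
  move=> [[A FA At]|G0t] [[B FB Bu]|G0u]; last by exists G0.
  - have [AB|BA] := Ftot _ _ FA FB.
      by exists (B `|` G0); split; [exact: FP|exact: FF|left; exact: AB|left].
    by exists (A `|` G0); split; [exact: FP|exact: FF|left|left; exact: BA].
  - by exists (A `|` G0); split; [exact: FP|exact: FF|left|right].
  - by exists (B `|` G0); split; [exact: FP|exact: FF|right|left].
(* A pairing graph larger than [G `|` G0] absorbs [G0], so it is a competitor of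
   [G] in Zorn's lemma. *)
exists (G `|` G0); split=> //.
  apply/infiniteP; apply: (@inj_card_le_set _ _ _ _ i) => [m _|m n _ _ /ii//].
  by exists (i (h (m, m))); right; exists m, m.
move=> H gH GH t Ht; apply: contrapT => nt; apply: (Gmax H).
  split; first by move=> u Gu; apply: GH; left.
  by move=> /(_ t Ht) Gt; apply: nt; left.
by rewrite /= setUidl // => u G0u; apply: GH; right.
Qed.

(** Take a maximal pairing graph, with field A. If the complement of A injects
    into A, then T injects into A, on which a pairing function is at hand.
    Otherwise A has a disjoint copy j(A) in its complement, and the pairing
    function extends to the union of both, contradicting maximality. *)
Lemma card_le_prod_self (T : Type) :
  infinite_set [set: T] -> [set: T * T] #<= [set: T].
Proof.
move=> /exists_maximal_pairing_graph[M [gM infM Mmax]].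
have [M1 M2 M3 M4] := gM.
pose A := pairing_field M.
have [f Mf] : exists f : A -> A -> A, forall a b,
    M (set_val a, set_val b, set_val (f a b)).
  have fex (a b : A) : {c : A | M (set_val a, set_val b, set_val c)}.
    apply: cid; have [c Mc] := M4 _ _ (set_valP a) (set_valP b).
    by have [_ _ Ac] := M3 _ _ _ Mc; exists (SigSub (mem_set Ac)).
  by exists (fun a b => sval (fex a b)) => a b; exact: (svalP (fex a b)).
have fi a b a' b' : f a b = f a' b' -> a = a' /\ b = b'.
  move=> fE; have := Mf a b; rewrite fE => /M2 /(_ (Mf a' b'))[].
  by move=> /val_inj -> /val_inj ->.
have [p pi] : exists p : bool -> A, injective p.
  move/infiniteP: infM; rewrite -(card_le_eqr (card_setT _)).
  move=> /card_leT_inj[g gi]; exists (fun b : bool => g b) => b c /gi.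
  by case: b; case: c.
have [|] := card_le_total (~` A) A.
  rewrite -(card_le_eql (card_setT _)) -(card_le_eqr (card_setT _)).
  move=> /card_leT_inj[k ki].
  (* [p true] and [p false] tag the points of A and those of its complement. *)
  pose h x : A := match pselect (A x) with
    | left Ax => f (p true) (SigSub (mem_set Ax))
    | right nAx => f (p false) (k (SigSub (mem_set (nAx : (~` A) x)))) end.
  have hi : injective h.
    move=> x y; rewrite /h.
    case: pselect => [Ax|nAx]; case: pselect => [Ay|nAy] /fi[].
    - by move=> _ [].
    - by move=> /pi.
    - by move=> /pi.
    - by move=> _ /ki [].
  apply: (@card_le_inj _ _ (fun u => set_val (f (h u.1) (h u.2)))).
  by move=> [x y] [x' y'] /val_inj /fi /= [/hi -> /hi ->].
rewrite -(card_le_eql (card_setT _)) -(card_le_eqr (card_setT _)).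
move=> /card_leT_inj[j ji].
(* [i] identifies bool * A with the union of A and j(A). The map [q] extends [f]
   and sends all the new pairs into j(A), tagged by the copies of A that they
   come from. *)
pose i (u : bool * A) := if u.1 then set_val (j u.2) else set_val u.2.
have jA a : ~ A (set_val (j a)) := set_valP (j a).
have ii : injective i.
  move=> [[] a] [[] b]; rewrite /i /=.
  - by move=> /val_inj/ji ->.
  - by move=> jab; case: (jA a); rewrite jab; exact: set_valP.
  - by move=> jab; case: (jA b); rewrite -jab; exact: set_valP.
  - by move=> /val_inj ->.
pose q (u v : bool * A) :=
  if u.1 || v.1 then (true, f (f (p u.1) (p v.1)) (f u.2 v.2))
  else (false, f u.2 v.2).
have qi u v u' v' : q u v = q u' v' -> u = u' /\ v = v'.
  move: u v u' v' => [s a] [t b] [s' a'] [t' b']; rewrite /q /=.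
  case: ifPn => [st|/norP[/negPf-> /negPf->]];
    case: ifPn => [st'|/norP[/negPf-> /negPf->]] // [] /fi[].
    by move=> /fi[/pi -> /pi ->] /fi[-> ->].
  by move=> -> ->.
have gG := pairing_graph_fun ii qi.
have MG := Mmax _ gG.
have /MG GM : M `<=` [set t | exists a b, t = (i a, i b, i (q a b))].
  move=> [[x y] z] Mxyz; have [Ax Ay _] := M3 _ _ _ Mxyz.
  exists (false, SigSub (mem_set Ax)), (false, SigSub (mem_set Ay)).
  by congr (_, _, _); exact: M1 Mxyz (Mf (SigSub (mem_set Ax)) (SigSub (mem_set Ay))).
case: (jA (p true)).
suff /GM Mj : [set t | exists a b, t = (i a, i b, i (q a b))]
    (i (true, p true), i (true, p true), i (q (true, p true) (true, p true))).
  by exists (i (q (true, p true) (true, p true))).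
by exists (true, p true), (true, p true).
Qed.

(** * Absorption by an infinite power *)

Lemma card_le_prodr (T U : Type) : T -> [set: U] #<= [set: T * U].
Proof. by move=> t0; apply: (@card_le_inj _ _ (pair t0)) => u v []. Qed.

Lemma infinite_prod (T U : Type) :
  T -> infinite_set [set: U] -> infinite_set [set: T * U].
Proof.
move=> t0 /infiniteP Ui; apply/infiniteP; apply: (card_le_trans Ui).
exact: card_le_prodr.
Qed.

Lemma card_le_cst (K D : Type) : K -> [set: D] #<= [set: K -> D].
Proof.
by move=> k0; apply: (@card_le_inj _ _ (fun d _ => d)) => d e /(congr1 (@^~ k0)).
Qed.

Lemma infinite_two_points (T : Type) :
  infinite_set [set: T] -> exists t0 t1 : T, t0 <> t1.
Proof.
by move=> /infiniteP/card_leT_inj[f fi]; exists (f 0), (f 1) => /fi.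
Qed.

Lemma finite_card_le_infinite (T E : Type) (A : set T) :
  finite_set A -> infinite_set [set: E] -> A #<= [set: E].
Proof.
move=> /finite_set_countable cA /infiniteP; exact: card_le_trans.
Qed.

Lemma card_le_fun (A A' B B' : Type) : A ->
  [set: A] #<= [set: A'] -> [set: B] #<= [set: B'] ->
  [set: A -> B] #<= [set: A' -> B'].
Proof.
move=> a0 /card_leT_inj[f fi] /card_leT_inj[g gi].
pose r a' := if pselect (exists a, f a = a') is left e then sval (cid e) else a0.
have rK a : r (f a) = a.
  by rewrite /r; case: pselect => [e|[]]; [apply: fi; case: cid|exists a].
apply: (@card_le_inj _ _ (fun u a' => g (u (r a')))) => u v uv.
by apply/funext => a; apply: gi; have := congr1 (@^~ (f a)) uv; rewrite /= rK.
Qed.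

Lemma card_le_fun_fun (K D : Type) : infinite_set [set: K] ->
  [set: K -> K -> D] #<= [set: K -> D].
Proof.
move=> Ki; have [k0 _] := infinite_setN0 Ki.
apply: (@card_le_trans _ _ _ [set: K * K -> D]).
  apply: (@card_le_inj _ _ (fun u k => u k.1 k.2)) => u v uv.
  by apply/funext => k; apply/funext => l; exact: (congr1 (@^~ (k, l)) uv).
apply: card_le_fun; [exact: (k0, k0)|exact: card_le_prod_self|exact: card_lexx].
Qed.

(** A pair of functions is coded by a family of functions indexed by [K] that
    takes the first one at one index and the second one elsewhere. *)
Lemma card_le_fun_prod (K D : Type) : infinite_set [set: K] ->
  [set: (K -> D) * (K -> D)] #<= [set: K -> D].
Proof.
move=> Ki; have [k0 [k1 k01]] := infinite_two_points Ki.
apply: card_le_trans (card_le_fun_fun D Ki).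
apply: (@card_le_inj _ _ (fun u k => if pselect (k = k0) then u.1 else u.2)).
move=> [u v] [u' v'] E; congr (_, _).
  by have := congr1 (@^~ k0) E => /=; case: pselect.
have := congr1 (@^~ k1) E => /=; case: pselect => // k10.
by case: k01.
Qed.

Lemma card_le_set_fun (K D : Type) : infinite_set [set: D] ->
  [set: set K] #<= [set: K -> D].
Proof.
move=> /infinite_two_points[d0 [d1 d01]].
apply: (@card_le_inj _ _ (fun A k => if pselect (A k) then d0 else d1)) => A B AB.
apply/funext => k; have := congr1 (@^~ k) AB => /=.
case: pselect => a; case: pselect => b // d10; apply/propext; split=> //;
  by case: d01.
Qed.

Lemma card_le_bigcup (I T E : Type) (D : set I) (F : I -> set T) : E ->
  [set: E * E] #<= [set: E] -> D #<= [set: E] ->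
  (forall i, D i -> F i #<= [set: E]) ->
  \bigcup_(i in D) F i #<= [set: E].
Proof.
move=> e0 EE DE FE; apply: card_le_trans EE.
have [g [_ gi]] := card_le_exists_inj e0 DE.
have hex i : {h : T -> E |
    D i -> forall x y, F i x -> F i y -> h x = h y -> x = y}.
  apply: cid; have [Di|nDi] := pselect (D i); last by exists (fun=> e0).
  by have [h [_ hi]] := card_le_exists_inj e0 (FE i Di); exists h.
pose u x := if pselect (exists2 i, D i & F i x) is left e
  then let i := sval (cid2 e) in (g i, sval (hex i) x) else (e0, e0).
apply: (@inj_card_le_set _ _ _ _ u) => // x y xF yF; rewrite /u.
case: pselect => // ex; case: pselect => // ey.
case: cid2 => i Di Fix /=; case: cid2 => j Dj Fjy /= [/gi ij].
move: Fjy; rewrite -(ij Di Dj) => Fiy; exact: (svalP (hex i)).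
Qed.

(** * Dense sets, closures and tightness *)

Lemma card_le_range (T K : Type) (B : set T) :
  K -> B !=set0 -> B #<= [set: K] -> exists g : K -> T, range g = B.
Proof.
move=> k0 [b0 Bb0] /(card_le_exists_inj k0)[f [_ fi]].
exists (fun k => if pselect (exists2 b, B b & f b = k) is left e
                 then sval (cid2 e) else b0).
apply/seteqP; split=> [_ [k _ <-]|b Bb].
  by case: pselect => // e; case: cid2.
exists (f b) => //; case: pselect => [e|[]]; last by exists b.
by case: cid2 => c Bc /= /fi; exact.
Qed.

Lemma closure_dense_open (X : topologicalType) (S V : set X) (x : X) :
  dense S -> open_nbhs x V -> closure (S `&` V) x.
Proof.
move=> dS [oV Vx] U; rewrite nbhsE => -[O [oO Ox] OU].
have [|y [[Oy Vy] Sy]] := dS (O `&` V) _ (openI oO oV); first by exists x.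
by exists y; split; [split|exact: OU].
Qed.

Lemma closure_set_type (X : topologicalType) (C A : set X) (x : C) :
  A `<=` C -> closure A (set_val x) -> closure (set_val @^-1` A : set C) x.
Proof.
move=> AC Ax U [O [[V oV <-] Vx] VU].
have [y [Ay Vy]] : A `&` V !=set0 by apply: Ax; exact: open_nbhs_nbhs.
exists (SigSub (mem_set (AC y Ay))); split=> //; exact: VU.
Qed.

Lemma closure_set_val (X : topologicalType) (C : set X) (B : set C) (x : C) :
  closure B x -> closure (set_val @` B) (set_val x).
Proof.
move=> Bx U xU; have [y [By Uy]] := Bx _ (@initial_continuous C X set_val x U xU).
by exists (set_val y); split=> //; exists y.
Qed.

(** Tightness of the subspace [C], expressed inside [X]. *)
Lemma tightness_set_type (X : topologicalType) (C : set X) (K : Type)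
    (A : set X) (x : X) :
  [set: tightness (set_type C)] #<= [set: K] ->
  A `<=` C -> C x -> closure A x ->
  exists B : set X, [/\ B `<=` A, B #<= [set: K] & closure B x].
Proof.
move=> tC AC Cx Ax; pose x' : C := SigSub (mem_set Cx).
have [B [BA BK Bx]] := (tightnessP (set_type C)).1.2 _ x' (closure_set_type (x := x') AC Ax).
exists (set_val @` B); split.
- by move=> _ [y /BA Ay <-].
- exact: card_le_trans (card_image_le _ _) (card_le_trans BK tC).
- exact: (closure_set_val Bx).
Qed.

(** If every point is in the closure of a small subset of [C], a small dense
    set can be moved inside [C]. *)
Lemma exists_small_dense (X : topologicalType) (C S : set X) (E : Type) : E ->
  [set: E * E] #<= [set: E] -> dense S -> S #<= [set: E] ->
  (forall x, exists B : set X, [/\ B `<=` C, B #<= [set: E] & closure B x]) ->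
  exists S' : set X, [/\ S' `<=` C, dense S' & S' #<= [set: E]].
Proof.
move=> e0 EE dS SE /choice[B BP]; exists (\bigcup_(x in S) B x); split.
- by move=> y [x _]; have [+ _ _] := BP x; exact.
- move=> O O0 oO; have [x [Ox Sx]] := dS O O0 oO.
  have [_ _ Bx] := BP x; have [|y [Bxy Oy]] := Bx O; first exact: open_nbhs_nbhs.
  by exists y; split=> //; exists x.
- by apply: card_le_bigcup => // x _; have [] := BP x.
Qed.

(** * The cardinality bound *)

(** A set [C] of tightness at most [W] with a dense subset of size at most
    D ^ (P * W) has size at most D ^ (P * W), when the n-closed pseudocharacter
    is at most [P]. *)
Lemma card_le_tight_dense (n : nat) (X : topologicalType) (P W D : Type)
    (V : P -> X -> set X) (C S : set X) :
  P -> infinite_set [set: W] -> infinite_set [set: D] ->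
  (forall p x, open_nbhs x (V p x)) ->
  (forall x : 'I_n -> X, injective x ->
     \bigcap_(i in [set: 'I_n])
        \bigcap_(p in [set: P]) closure (V p (x i)) = set0) ->
  S `<=` C -> dense S -> S #<= [set: P * W -> D] ->
  (forall A x, A `<=` C -> C x -> closure A x ->
     exists B : set X, [/\ B `<=` A, B #<= [set: W] & closure B x]) ->
  C #<= [set: P * W -> D].
Proof.
move=> p0 Wi Di Vx V0 SC dS SE tC.
have [w0 _] := infinite_setN0 Wi; have [d0 _] := infinite_setN0 Di.
have Ki := infinite_prod p0 Wi.
pose e0 (_ : P * W) := d0.
have GP (xp : X * P) : exists g : W -> X, C xp.1 ->
    range g `<=` S `&` V xp.2 xp.1 /\ closure (range g) xp.1.
  move: xp => [x p] /=; have [Cx|nCx] := pselect (C x); last by exists (fun=> x).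
  have [||B [BS BW Bx]] := tC (S `&` V p x) x _ Cx.
  - by move=> y [/SC].
  - exact: closure_dense_open.
  have [|g gB] := card_le_range w0 _ BW; last by exists g; rewrite gB.
  by have [y [By _]] := Bx _ filterT; exists y.
(* [G (x, p)] enumerates, along [W], a subset of [S `&` V p x] whose closure
   contains [x]. *)
have [G {}GP] := choice GP.
have GSV x p w : C x -> (S `&` V p x) (G (x, p) w).
  by move=> Cx; have [gSV _] := GP (x, p) Cx; apply: gSV; exists w.
have [s [_ si]] := card_le_exists_inj e0 SE.
(* [F x] is the code of [x], with the points of [S] renamed by [s]. *)
pose F x : P * W -> P * W -> D := fun k => s (G (x, k.1) k.2).
have FG x y p w : C x -> C y -> F x = F y -> G (x, p) w = G (y, p) w.
  move=> Cx Cy Fxy; apply: si; last exact: (congr1 (@^~ (p, w)) Fxy).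
  - by have [] := GSV x p w Cx.
  - by have [] := GSV y p w Cy.
(* [C] is the union of the fibres of [F]; each of them is finite, for otherwise
   it contains n distinct points. *)
have -> : C = \bigcup_(e in [set: P * W -> P * W -> D]) (C `&` F @^-1` [set e]).
  by apply/seteqP; split=> [x Cx|x [e _ []]//]; exists (F x).
apply: card_le_bigcup => //; first exact: card_le_fun_prod.
  exact: card_le_fun_fun.
move=> e _; apply: finite_card_le_infinite; last first.
  apply/infiniteP; apply: (@card_le_trans _ _ _ [set: D]); first exact/infiniteP.
  exact: (card_le_cst D (p0, w0)).
apply: contrapT => fib; have [x0 [Cx0 Fx0]] := infinite_setN0 fib.
move/infiniteP: fib => /(card_le_exists_inj x0)[u [uF ui]].
have uI : injective (fun i : 'I_n => u i).
  by move=> i j /(ui _ _ I I) /val_inj.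
suff : set0 x0 by [].
rewrite -(V0 _ uI) => i _ p _; have [Cu Fu] := uF i I.
have [_ gx] := GP (x0, p) Cx0.
have := gx; apply: closureS => _ [w _ <-].
rewrite (FG x0 (u i) p w) //; last by rewrite Fx0 Fu.
by have [] := GSV (u i) p w Cu.
Qed.

Theorem theorem3p11 (n : nat) (hn : (2 <= n)%N) (X : topologicalType)
    (hX : n_urysohn n X) :
  [set: X] #<=
    [set: (closed_pseudocharacter n X * weak_tightness X)%type -> density X].
Proof.
have [[Pi [V [Vx V0]]] _] := closed_pseudocharacterP hX.
have [[Wi [CC [CCW CCX CCP]]] _] := weak_tightnessP X.
have [[Di [S dS SD]] _] := densityP X.
move: (closed_pseudocharacter n X) (weak_tightness X) (density X)
  Pi V Vx V0 Wi CCW CCP Di SD.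
move=> P W D /infinite_setN0[p0 _] V Vx V0 Wi CCW CCP Di SD.
have Ki := infinite_prod p0 Wi.
have [d0 _] := infinite_setN0 Di; have [w0 _] := infinite_setN0 Wi.
pose e0 (_ : P * W) := d0.
have EE := card_le_fun_prod D Ki.
have DE : [set: D] #<= [set: P * W -> D] := card_le_cst D (p0, w0).
have WE : [set: set W] #<= [set: P * W -> D].
  apply: card_le_trans (card_le_set_fun _ Di); apply: card_le_set.
  exact: card_le_prodr.
rewrite -CCX; apply: card_le_bigcup => //; first exact: card_le_trans WE.
move=> C /CCP[tC CX].
have [|S' [S'C dS' S'E]] := @exists_small_dense X C S _ e0 EE dS (card_le_trans SD DE).
  move=> x; have [B [BC BW] Bx] : (\bigcup_(B in
      [set B : set X | B `<=` C /\ B #<= [set: set W]]) closure B) x by rewrite CX.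
  by exists B; split=> //; exact: card_le_trans WE.
apply: card_le_tight_dense Vx V0 S'C dS' S'E _ => // A x.
exact: tightness_set_type.
Qed.
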